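(* Let $G$ be a Polish group and let $X$ be a quasi-Polish space equipped with a Borel action $\alpha : G \times X \to X$ of $G$ (Borel with respect to the Borel $\sigma$-algebras generated by the topologies). Then: (a) The action is jointly continuous if and only if $\mathcal{O}(G) \circledast \mathcal{O}(X) = \mathcal{O}(X)$, i.e., the sets $U * A$ for $U \in \mathcal{O}(G)$ and $A \in \mathcal{O}(X)$ are open and form an open (sub)basis for $X$. (b) If $\mathcal{O}(G) \circledast \mathcal{O}(X) \subseteq \mathcal{O}(X)$, then $\mathcal{O}(G) \circledast \mathcal{O}(X)$ is a topology on $X$, coarser than $\mathcal{O}(X)$, which is a compatible quasi-Polish topology (i.e., quasi-Polish and contained in the Borel $\sigma$-algebra of $X$) and for which the action is jointly continuous.
   Context: $\mathcal{O}(Z)$ denotes the topology (set of open sets) of a space $Z$. Quasi-Polish spaces are in the sense of de Brecht (equivalently, spaces homeomorphic to a $\boldsymbol{\Pi}^0_2$ subspace of $\mathbb{S}^{\mathbb{N}}$, $\mathbb{S}$ the Sierpinski space). For Borel $U \subseteq G$ and Borel $A \subseteq X$, the Vaught transform is $U * A := \{x \in X \mid \exists^* g \in G\, (g \in U \text{ and } x \in gA)\}$, where $\exists^* g \in G$ means ''for a nonmeager set of $g \in G$''. For a family $\mathcal{S}$ of Borel subsets of $X$, $\mathcal{O}(G) \circledast \mathcal{S} := \{\bigcup_i (U_i * A_i) \mid U_i \in \mathcal{O}(G),\ A_i \in \mathcal{S}\}$, where $i$ ranges over countable index sets. *)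

(* Defs.v *)
From HB Require Import structures.
From mathcomp Require Import all_boot all_order all_algebra.
From mathcomp Require Import all_classical all_reals all_analysis.

Set Implicit Arguments.
Unset Strict Implicit.
Unset Printing Implicit Defensive.

Import Order.TTheory GRing.Theory Num.Theory.

Local Open Scope classical_set_scope.
Local Open Scope ring_scope.

HB.mixin Record isTopologicalGroup G & Topological G & Group G := {
  mulg_continuous : continuous (fun p : G * G => (p.1 * p.2)%g) ;
  invg_continuous : continuous (fun g : G => (g^-1)%g)
}.

#[short(type="topologicalGroupType")]
HB.structure Definition TopologicalGroup :=
  {G of Topological G & Group G & isTopologicalGroup G}.

Section polish.
Variable R : realType.

Definition is_metric (T : Type) (d : T -> T -> R) :=
  [/\ forall x y, 0 <= d x y,
      forall x y, d x y = 0 <-> x = y,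
      forall x y, d x y = d y x
    & forall x y z, d x z <= d x y + d y z].

Definition metrizes (T : topologicalType) (d : T -> T -> R) :=
  forall x : T, nbhs x = filter_from [set e : R | 0 < e]
                                     (fun e => [set y | d x y < e]).

Definition complete_metric (T : topologicalType) (d : T -> T -> R) :=
  forall u : nat -> T,
    (forall e : R, 0 < e -> exists N : nat, forall m n : nat,
       (N <= m)%N -> (N <= n)%N -> d (u m) (u n) < e) ->
    exists l : T, u @ \oo --> l.

Definition completely_metrizable (T : topologicalType) :=
  exists d : T -> T -> R, [/\ is_metric d, metrizes d & complete_metric d].

Definition separable_space (T : topologicalType) :=
  exists2 D : set T, countable D & dense D.

Definition polish (T : topologicalType) :=
  separable_space T /\ completely_metrizable T.

End polish.

Definition homeomorphic (S T : topologicalType) :=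
  exists (f : S -> T) (g : T -> S),
    [/\ cancel f g, cancel g f, continuous f & continuous g].

Definition sierpinski : Type := bool.

HB.instance Definition _ := Choice.on sierpinski.

Section sierpinski_topology.

(* The open sets are set0, [set true] and setT. *)
Definition sierpinski_open : set (set sierpinski) :=
  [set A | A false -> A true].

Lemma sierpinski_openT : sierpinski_open setT.
Proof. by []. Qed.

Lemma sierpinski_openI : setI_closed sierpinski_open.
Proof. by move=> A B oA oB [/oA At /oB Bt]. Qed.

Lemma sierpinski_open_bigU (I : Type) (f : I -> set sierpinski) :
  (forall i, sierpinski_open (f i)) -> sierpinski_open (\bigcup_i f i).
Proof. by move=> of_ [i _ /of_ fit]; exists i. Qed.

HB.instance Definition _ := isOpenTopological.Build sierpinski
  sierpinski_openT sierpinski_openI sierpinski_open_bigU.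

End sierpinski_topology.

(* In a non-metrizable space open sets need not be countable unions of closed
   sets, so the second level of the Borel hierarchy starts from differences of
   open sets. *)
Definition Sigma02 (T : topologicalType) (A : set T) :=
  exists U V : nat -> set T,
    [/\ forall n, open (U n), forall n, open (V n)
      & A = \bigcup_n (U n `\` V n)].

Definition Pi02 (T : topologicalType) (A : set T) := Sigma02 (~` A).

Definition quasi_polish (T : topologicalType) :=
  exists A : set {ptws nat -> sierpinski},
    Pi02 A /\ homeomorphic T (set_type A).

Definition borel (T : topologicalType) : set (set T) := <<s @open T >>.

Definition borel_map (S T : topologicalType) (f : S -> T) :=
  forall B : set T, borel B -> borel (f @^-1` B).

Definition nowhere_dense (T : topologicalType) (A : set T) :=
  interior (closure A) = set0.

Definition meager (T : topologicalType) (A : set T) :=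
  exists2 F : nat -> set T, forall n, nowhere_dense (F n) &
    A = \bigcup_n F n.

Definition left_action (G : groupType) (X : Type) (alpha : G * X -> X) :=
  (forall x, alpha (1%g, x) = x) /\
  (forall g h x, alpha ((g * h)%g, x) = alpha (g, alpha (h, x))).

Definition vaught (G : topologicalType) (X : Type) (alpha : G * X -> X)
    (U : set G) (A : set X) : set X :=
  [set x | ~ meager [set g | U g /\ [set alpha (g, a) | a in A] x]].

Definition vaught_unions (G : topologicalType) (X : Type) (alpha : G * X -> X)
    (UU : set (set G)) (SS : set (set X)) : set (set X) :=
  [set B | exists (I : set nat) (U : nat -> set G) (A : nat -> set X),
     [/\ forall i, I i -> UU (U i), forall i, I i -> SS (A i)
       & B = \bigcup_(i in I) vaught alpha (U i) (A i)]].

Definition subbasis (T : topologicalType) (B : set (set T)) :=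
  B `<=` open /\ basis (finI_from B id).

Definition is_topology (T : Type) (O : set (set T)) :=
  [/\ O setT, setI_closed O
    & forall F : set (set T), F `<=` O -> O (\bigcup_(A in F) A)].

(* The carrier of T equipped with the topology O. *)
Definition topologized (T : choiceType) (O : set (set T))
  (_ : is_topology O) : Type := T.

Section topologized_topology.
Variables (T : choiceType) (O : set (set T)) (topO : is_topology O).

HB.instance Definition _ := Choice.on (topologized topO).

Let openT : O setT. Proof. by case: topO. Qed.

Let openI : setI_closed O. Proof. by case: topO. Qed.

Let open_bigU (I : Type) (f : I -> set T) :
  (forall i, O (f i)) -> O (\bigcup_i f i).
Proof.
case: topO => _ _ OU Of; suff -> : \bigcup_i f i = \bigcup_(A in range f) A.
  by apply: OU => _ [i _ <-].
by rewrite bigcup_image.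
Qed.

HB.instance Definition _ := isOpenTopological.Build (topologized topO)
  openT openI open_bigU.

Lemma open_topologizedE : @open (topologized topO) = O.
Proof. by []. Qed.

End topologized_topology.

(* Main.v *)
(** Write U * A for the Vaught transform.  If k is a point of local
nonmeagerness of [set g | A (g^-1 x)] and W, C are neighbourhoods of 1 and k
with W C contained in U, then x lies in C * A and W . (C * A) in U * A.  This
single observation yields both the continuity of the action for the topology
generated by the sets U * A and the closure of that family of unions under
intersections.

For quasi-Polishness, a space is quasi-Polish if and only if it is T0 and has a
countable base together with a refinement relation whose chains are
neighbourhood bases of some point; the second property passes to products,
Pi02 subspaces and continuous open images.  Call x good when x in A implies
x in V * A for all open A and all neighbourhoods V of 1.  The good points form a
Pi02 subset X' of X, and g^-1 x is good for comeagerly many g, so the action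
restricts to a continuous open surjection from G * X' onto X with the topology
of the U * A.  The latter is T0 because Borel sets have the Baire property. *)

Require Import Defs.
From mathcomp Require Import finmap all_boot all_order all_algebra.
From mathcomp Require Import all_classical all_reals all_analysis.
From mathcomp Require Import lra.

Set Implicit Arguments.
Unset Strict Implicit.
Unset Printing Implicit Defensive.

Import Order.TTheory GRing.Theory Num.Theory.

Local Open Scope classical_set_scope.

Lemma countable_range (T : Type) (A : set T) : countable A ->
  A = set0 \/ exists f : nat -> T, A = range f.
Proof.
by move=> /pfcard_geP[->|[f]]; [left|right; exists f; rewrite image_eq].
Qed.

Lemma countable_dependent_choice (T : Type) (A : set T) (x0 : T)
    (P : nat -> T -> T -> Prop) :
  A x0 -> (forall n x, A x -> exists2 y, A y & P n x y) ->
  exists2 u : nat -> T, u 0%N = x0 & forall n, A (u n) /\ P n (u n) (u n.+1).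
Proof.
move=> Ax0 next.
have step (p : nat * {x | A x}) :
    {q : nat * {x | A x} | q.1 = p.1.+1 /\ P p.1 (sval p.2) (sval q.2)}.
  case: p => n [x Ax]; apply/cid; have [y Ay Pxy] := next n x Ax.
  by exists (n.+1, exist _ y Ay).
have [f [f0 fP]] := dependent_choice step (0%N, exist _ x0 Ax0).
have fn n : (f n).1 = n by elim: n => [|n IH]; [rewrite f0|rewrite (fP n).1 IH].
exists (fun n => sval (f n).2); first by rewrite f0.
move=> n; split; first exact: (svalP (f n).2).
by have [_] := fP n; rewrite fn.
Qed.

Lemma subset_countable (T : Type) (A B : set T) :
  A `<=` B -> countable B -> countable A.
Proof. by move=> AB; apply: sub_countable; exact: subset_card_le. Qed.

Lemma nonincreasing_sets (T : Type) (F : nat -> set T) (m n : nat) :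
  (forall i, F i.+1 `<=` F i) -> (m <= n)%N -> F n `<=` F m.
Proof.
move=> decF; apply: (@homo_leq _ F (fun A B => B `<=` A)) => [A|B A C|i] //.
by move=> BA CB; exact: subset_trans CB BA.
Qed.

(** * Bases of topologies *)

Lemma basisP (T : topologicalType) (D : set (set T)) : basis D <->
  D `<=` open /\ forall V x, open V -> V x ->
    exists U, [/\ D U, U x & U `<=` V].
Proof.
split=> -[oD bD]; split=> //.
  move=> V x oV Vx.
  by have [|U [DU Ux] UV] := bD x V; [exact: open_nbhs_nbhs|exists U].
move=> x N; rewrite nbhsE => -[V [oV Vx] VN].
have [U [DU Ux UV]] := bD V x oV Vx.
by exists U => //; exact: subset_trans VN.
Qed.

Lemma kolmogorov_spaceP (T : topologicalType) : kolmogorov_space T <->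
  forall x y : T, (forall U, open U -> (U x <-> U y)) -> x = y.
Proof.
split=> [T0 x y xy|T0 x y /eqP xy].
  apply/eqP/negPn/negP => /T0[A []] [/set_mem + /set_mem nA];
    rewrite nbhsE => -[U [oU Ux] UA]; apply/nA/UA; exact/(xy U oU).
apply: contrapT => /forallNP nsep; apply/xy/T0 => U oU.
split=> [Ux|Uy]; apply: contrapT => nU; apply: (nsep U).
  by left; rewrite !inE; split=> //; exact: open_nbhs_nbhs.
by right; rewrite !inE; split=> //; exact: open_nbhs_nbhs.
Qed.

Lemma kolmogorov_basis_eq (T : topologicalType) (D : set (set T)) (x y : T) :
  kolmogorov_space T -> basis D -> (forall U, D U -> (U x <-> U y)) -> x = y.
Proof.
move=> /kolmogorov_spaceP T0 /basisP[_ bD] xy; apply: T0 => U oU.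
by split=> [/(bD _ _ oU)|/(bD _ _ oU)] [W [DW Wz WU]]; apply/WU/(xy W DW).
Qed.

Definition union_closure (T : Type) (D : set (set T)) : set (set T) :=
  [set B | forall x, B x -> exists U, [/\ D U, U x & U `<=` B]].

Section union_closure.
Context {T : Type}.
Implicit Types D O : set (set T).

Lemma sub_union_closure D : D `<=` union_closure D.
Proof. by move=> U DU x Ux; exists U; split. Qed.

Lemma union_closure_topology D :
  (forall x, exists2 U, D U & U x) ->
  (forall U V, D U -> D V -> union_closure D (U `&` V)) ->
  is_topology (union_closure D).
Proof.
move=> coverD interD; split.
- by move=> x _; have [U DU Ux] := coverD x; exists U; split.
- move=> A B oA oB x [/oA[U [DU Ux UA]] /oB[V [DV Vx VB]]].
  have [W [DW Wx WUV]] := interD U V DU DV x (conj Ux Vx).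
  by exists W; split=> // y /WUV[/UA ? /VB].
- move=> F oF x [A FA Ax]; have [U [DU Ux UA]] := oF A FA x Ax.
  by exists U; split=> // y /UA ?; exists A.
Qed.

Lemma finI_from_topology D O : is_topology O -> D `<=` O ->
  finI_from D id `<=` O.
Proof.
move=> [OT OI _] DO _ [F FD <-]; rewrite bigcap_fset big_seq.
by elim/big_ind: _ => // A /FD; rewrite inE => /DO.
Qed.

End union_closure.

Section basis_union_closure.
Context {T : topologicalType}.
Implicit Types D : set (set T).

Lemma union_closure_open D : D `<=` open -> union_closure D `<=` open.
Proof.
move=> oD B BD; rewrite openE => x /BD[U [/oD oU Ux UB]].
by apply: filterS UB _; exact: open_nbhs_nbhs.
Qed.

Lemma union_closure_basisP D : union_closure D = open <-> basis D.
Proof.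
rewrite basisP; split=> [DE|[oD bD]].
  split=> [|V x]; first by rewrite -DE; exact: sub_union_closure.
  by rewrite -DE => BV; exact: BV.
by apply/seteqP; split=> [|V oV x]; [exact: union_closure_open|exact: bD].
Qed.

Lemma union_closure_subbasisP D :
  (union_closure D `<=` open -> is_topology (union_closure D)) ->
  union_closure D = open <-> subbasis D.
Proof.
move=> topD; split=> [DE|[oD /basisP[_ bD]]].
  have /basisP[oD bD] := (union_closure_basisP D).1 DE.
  split=> //; apply/basisP; split=> [|V x oV /(bD _ _ oV)[U [DU Ux UV]]].
    by rewrite -DE; apply: finI_from_topology;
      [apply: topD; rewrite DE|exact: sub_union_closure].
  by exists U; split=> //; exact: (@finI_from1 _ _ D id).
have oDU := union_closure_open oD; apply/seteqP; split=> // V oV x Vx.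
have [U [DU Ux UV]] := bD V x oV Vx.
have [W [DW Wx WU]] :=
  finI_from_topology (topD oDU) (@sub_union_closure _ D) DU x Ux.
by exists W; split=> //; exact: subset_trans UV.
Qed.

End basis_union_closure.

(** * Meager sets and the Baire property *)

Definition baire_space (T : topologicalType) :=
  forall V : set T, open V -> V !=set0 -> ~ meager V.

Definition locally_nonmeager (T : topologicalType) (S : set T) (x : T) :=
  forall V, open V -> V x -> ~ meager (S `&` V).

Definition baire_property (T : topologicalType) (S : set T) :=
  exists2 U, open U & meager (S `+` U).

Section meager.
Context {T : topologicalType}.
Implicit Types A B S U V : set T.

Lemma nowhere_denseP A : nowhere_dense A <->
  forall V, open V -> V !=set0 ->
    exists W, [/\ open W, W !=set0, W `<=` V & W `&` A = set0].
Proof.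
split=> [ndA V oV [x Vx]|avoid].
  have /existsNP[y /not_implyP[Vy nAy]] : ~ (V `<=` closure A).
    move=> VA; suff : interior (closure A) x by rewrite ndA.
    by apply: (filterS VA); exact: open_nbhs_nbhs.
  exists (V `\` closure A); split.
  - by apply: openI => //; apply: closed_openC; exact: closed_closure.
  - by exists y.
  - by move=> ? [].
  - by apply/seteqP; split=> // z [[_ nz] /subset_closure].
apply/seteqP; split=> // x xA.
have [||W [oW [z Wz] WA /seteqP[W0 _]]] := avoid (interior (closure A)).
- exact: open_interior.
- by exists x.
have /WA/interior_subset/(_ W)[|w [Aw Ww]] := Wz; first exact: open_nbhs_nbhs.
exact: (W0 w).
Qed.

Lemma sub_nowhere_dense A B : A `<=` B -> nowhere_dense B -> nowhere_dense A.
Proof.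
move=> AB ndB; apply/seteqP; split=> // x.
by rewrite -ndB; apply: filterS; exact: closure_subset.
Qed.

Lemma nowhere_dense0 : nowhere_dense (set0 : set T).
Proof. by rewrite /nowhere_dense closure0 interior0. Qed.

Lemma open_frontier_nowhere_dense U : open U -> nowhere_dense (closure U `\` U).
Proof.
move=> oU; apply/nowhere_denseP => W oW [x Wx].
have [[y [Wy Uy]]|WU0] := pselect (W `&` U !=set0).
  exists (W `&` U); split; [exact: openI|by exists y|by move=> ? []|].
  by apply/seteqP; split=> // z [[_ ?] []].
exists W; split=> //; first by exists x.
apply/seteqP; split=> // z [Wz [/(_ W) []]]; first exact: open_nbhs_nbhs.
by move=> w [Uw Ww]; case: WU0; exists w.
Qed.

Lemma nowhere_dense_meager A : nowhere_dense A -> meager A.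
Proof. by move=> ndA; exists (fun=> A) => //; rewrite bigcup_const. Qed.

Lemma sub_meager A B : A `<=` B -> meager B -> meager A.
Proof.
move=> AB [F ndF FB]; exists (fun n => F n `&` A).
  by move=> n; apply: sub_nowhere_dense (ndF n) => x [].
by rewrite -setI_bigcupl -FB setIC; apply/esym/setIidPl.
Qed.

Lemma meager0 : meager (set0 : set T).
Proof. exact/nowhere_dense_meager/nowhere_dense0. Qed.

Lemma meager_bigcup (I : Type) (D : set I) (A : I -> set T) :
  countable D -> (forall i, D i -> meager (A i)) ->
  meager (\bigcup_(i in D) A i).
Proof.
move=> /countable_range[->|[f ->]] mA.
  by rewrite bigcup_set0; exact: meager0.
have /choice[F FP] : forall n, exists F : nat -> set T,
    (forall m, nowhere_dense (F m)) /\ A (f n) = \bigcup_m F m.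
  by move=> n; have [|F ? ?] := mA (f n); [exists n|exists F].
exists (fun k => if unpickle k is Some (n, m) then F n m else set0).
  by move=> k; case: unpickle => [[n m]|]; [case: (FP n)|exact: nowhere_dense0].
rewrite bigcup_image; apply/seteqP; split=> x [n _].
  rewrite /= (FP n).2 => -[m _ Fx].
  by exists (pickle (n, m)) => //; rewrite pickleK.
case: unpickle => // -[k m] Fx; exists k => //.
by rewrite /= (FP k).2; exists m.
Qed.

Lemma meagerU A B : meager A -> meager B -> meager (A `|` B).
Proof.
move=> mA mB; rewrite -bigcup2E; apply: meager_bigcup; first exact: countableP.
by move=> [|[|n]] _ //=; exact: meager0.
Qed.

Lemma nonmeager_bigcup (I : Type) (D : set I) S (A : I -> set T) :
  countable D -> S `<=` \bigcup_(i in D) A i -> ~ meager S ->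
  exists2 i, D i & ~ meager (A i).
Proof.
move=> cD SA nS; apply: contrapT => /forall2NP nA; apply: nS.
apply: (sub_meager SA); apply: meager_bigcup => // i Di.
by case: (nA i) => // /contrapT.
Qed.

Lemma nonmeager_nonempty S : ~ meager S -> S !=set0.
Proof.
by move=> nS; apply/set0P/eqP => S0; apply: nS; rewrite S0; exact: meager0.
Qed.

Lemma meager_not_locally_nonmeager S : @second_countable T ->
  meager (S `\` locally_nonmeager S).
Proof.
move=> [D cD /basisP[_ bD]].
apply: (@sub_meager _
  (\bigcup_(U in [set U | D U /\ meager (S `&` U)]) (S `&` U))).
  move=> x [Sx /existsNP[V /not_implyP[oV /not_implyP[Vx /contrapT mSV]]]].
  have [U [DU Ux UV]] := bD V x oV Vx; exists U => //; split=> //.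
  by apply: sub_meager mSV; exact: setIS.
apply: meager_bigcup => [|U []//].
by apply: subset_countable cD => U [].
Qed.

Lemma nonmeager_locally_nonmeager S : @second_countable T -> ~ meager S ->
  S `&` locally_nonmeager S !=set0.
Proof.
move=> scT nS; apply: contrapT => nloc; apply: nS.
apply: sub_meager (meager_not_locally_nonmeager S scT) => x Sx; split=> // lx.
by apply: nloc; exists x.
Qed.

Lemma open_baire_property U : open U -> baire_property U.
Proof. by move=> oU; exists U => //; rewrite setYK; exact: meager0. Qed.

Lemma baire_propertyC S : baire_property S -> baire_property (~` S).
Proof.
move=> [U oU mSU]; exists (~` closure U).
  by apply: closed_openC; exact: closed_closure.
have := meagerU mSU (nowhere_dense_meager (open_frontier_nowhere_dense oU)).
apply: sub_meager => x [[nSx /contrapT clUx]|[nclUx /contrapT Sx]].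
  by have [Ux|nUx] := pselect (U x); [left; right|right].
by left; left; split=> // /subset_closure.
Qed.

Lemma baire_property_bigcup (S : nat -> set T) :
  (forall n, baire_property (S n)) -> baire_property (\bigcup_n S n).
Proof.
move=> bpS.
have /choice[U UP] : forall n, exists U, open U /\ meager (S n `+` U).
  by move=> n; have [U ? ?] := bpS n; exists U.
exists (\bigcup_n U n); first by apply: bigcup_open => n _; exact: (UP n).1.
apply: (@sub_meager _ (\bigcup_n (S n `+` U n))).
  move=> x [[[n _ Sx] nU]|[[n _ Ux] nS]]; exists n => //.
    by left; split=> // Ux; apply: nU; exists n.
  by right; split=> // Sx; apply: nS; exists n.
by apply: meager_bigcup; [exact: countableP|move=> n _; exact: (UP n).2].
Qed.

Lemma borel_baire_property S : borel S -> baire_property S.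
Proof.
apply: smallest_sub; last exact: open_baire_property.
split=> [|A|A]; [|rewrite setTD|].
- exact/open_baire_property/open0.
- exact: baire_propertyC.
- exact: baire_property_bigcup.
Qed.

Lemma nonmeager_baire_property S : baire_property S -> ~ meager S ->
  exists U, [/\ open U, U !=set0 & meager (U `\` S)].
Proof.
move=> [U oU mSU] nS; exists U; split=> //.
  apply/set0P/eqP => U0; apply: nS; apply: sub_meager mSU => x Sx.
  by rewrite U0 setY0.
by apply: sub_meager mSU => x; right.
Qed.

Lemma borelD A B : borel A -> borel B -> borel (A `\` B).
Proof.
have [borel0 borelC borelU] := @smallest_sigma_algebra T setT open.
move=> bA bB; rewrite setDE -[A]setCK -setCU -bigcup2E -setTD.
apply: (borelC); apply: borelU => -[|[|n]] //=.
by rewrite -setTD; exact: borelC.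
Qed.

Lemma meager_borelD A B : baire_space T -> borel A -> borel B ->
  (forall U, open U -> ~ meager (A `&` U) -> ~ meager (B `&` U)) ->
  meager (A `\` B).
Proof.
move=> baireT bA bB AB; apply: contrapT => nAB.
have [U [oU U0 mU]] :=
  nonmeager_baire_property (borel_baire_property (borelD bA bB)) nAB.
apply: (AB U oU).
  move=> mAU; apply: (baireT U oU U0).
  apply: sub_meager (meagerU mU mAU) => x Ux.
  by have [Ax|nAx] := pselect (A x); [right|left; split=> // -[]].
by apply: sub_meager mU => x [Bx Ux]; split=> // -[].
Qed.

End meager.

Definition open_map (S T : topologicalType) (f : S -> T) :=
  forall U, open U -> open (f @` U).

Lemma meager_preimage (S T : topologicalType) (f : S -> T) (A : set T) :
  continuous f -> open_map f -> meager A -> meager (f @^-1` A).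
Proof.
move=> /continuousP cf openf [F ndF ->].
rewrite preimage_bigcup; exists (fun n => f @^-1` F n) => // n.
apply/nowhere_denseP => V oV [x Vx].
have [||W [oW [w Ww] WV /seteqP[WF _]]] :=
    (nowhere_denseP (F n)).1 (ndF n) (f @` V).
- exact: openf.
- by exists (f x), x.
exists (f @^-1` W `&` V); split.
- by apply: openI => //; exact: cf.
- by have [y Vy yw] := WV _ Ww; exists y; split=> //; rewrite /= yw.
- by move=> ? [].
- by apply/seteqP; split=> // y [[Wy _] Fy]; exact: (WF (f y)).
Qed.

Lemma open_prod_box (S T : topologicalType) (V : set (S * T)) (p : S * T) :
  open V -> V p ->
  exists A B, [/\ open A, open B, A p.1, B p.2 & A `*` B `<=` V].
Proof.
rewrite openE => oV /oV[[A B] /= [nA nB] ABV]; exists A°, B°.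
split; [exact: open_interior|exact: open_interior|by []|by []|].
by move=> q [/interior_subset Aq /interior_subset Bq]; apply: ABV.
Qed.

Lemma open_setX (S T : topologicalType) (A : set S) (B : set T) :
  open A -> open B -> open (A `*` B).
Proof.
move=> oA oB; rewrite openE => p [Ap Bp]; exists (A, B) => //.
by split; exact: open_nbhs_nbhs.
Qed.

(** * Convergent bases *)

(* [R n k l] reads: B l is an admissible refinement of B k at stage n.  The
   stage lets R enforce countably many requirements along a chain, such as
   vanishing radii or the conditions cutting out a Pi02 set. *)
Definition convergent_base (T : topologicalType) (K : Type) (B : K -> set T)
    (R : nat -> K -> K -> Prop) :=
  [/\ basis (range B),
      forall n k l, R n k l -> B l `<=` B k,
      forall n k V x, open V -> V x -> B k x ->
        exists l, [/\ R n k l, B l x & B l `<=` V]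
    & forall s : nat -> K, (forall n, R n (s n) (s n.+1)) ->
        exists2 x, forall n, B (s n) x &
          forall V, open V -> V x -> exists n, B (s n) `<=` V].

Definition has_convergent_base (T : topologicalType) :=
  exists (K : countType) (B : K -> set T) (R : nat -> K -> K -> Prop),
    convergent_base B R.

Lemma convergent_base_chain (T : topologicalType) (K : Type) (B : K -> set T)
    (R : nat -> K -> K -> Prop) (s : nat -> K) (m n : nat) :
  convergent_base B R -> (forall i, R i (s i) (s i.+1)) -> (m <= n)%N ->
  B (s n) `<=` B (s m).
Proof.
move=> [_ sub_B _ _] chain_s.
by apply: (nonincreasing_sets (F := B \o s)) => i; exact: sub_B (chain_s i).
Qed.

Section has_convergent_base.
Context {T : topologicalType}.

Lemma has_convergent_base_second_countable :
  has_convergent_base T -> @second_countable T.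
Proof.
move=> [K [B [R [basisB _ _ _]]]]; exists (range B) => //.
exact: (card_le_trans (card_image_le _ _) (countableP _)).
Qed.

Lemma has_convergent_base_baire_space : has_convergent_base T -> baire_space T.
Proof.
move=> [K [B [R [/basisP[oB bB] _ refine chain_cvg]]]] V oV [x Vx] [F ndF VF].
have openB k : open (B k) by apply: oB; exists k.
have [_ [[k0 _ <-] Bx BV]] := bB V x oV Vx.
have [|n k [y By]|s s0 sP] := @countable_dependent_choice K
    [set k | B k !=set0] k0 (fun n k l => R n k l /\ B l `&` F n = set0).
- by exists x.
- have [|W [oW [z Wz] WB WF]] := (nowhere_denseP (F n)).1 (ndF n) _ (openB k).
    by exists y.
  have [l [Rkl Bz BW]] := refine n k W z oW Wz (WB z Wz).
  exists l; [by exists z|split=> //].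
  by apply/seteqP; split=> // w [/BW Ww Fw]; rewrite -WF.
have [y yB _] := chain_cvg s (fun n => (sP n).2.1).
have : V y by apply: BV; rewrite -s0.
rewrite VF => -[n _ Fy]; have [_ [_ /seteqP[+ _]]] := sP n.
by apply; split; [exact: yB|exact: Fy].
Qed.

Lemma has_convergent_base_image (S : topologicalType) (f : S -> T) :
  continuous f -> open_map f -> range f = setT ->
  has_convergent_base S -> has_convergent_base T.
Proof.
move=> /continuousP cf openf fT.
move=> [K [B [R [/basisP[oB bB] sub_B refine chain_cvg]]]].
exists K, (fun k => f @` B k), R; split.
- apply/basisP; split=> [_ [k _ <-]|V y oV].
    by apply: openf; apply: oB; exists k.
  have [x _ xy] : range f y by rewrite fT.
  rewrite -xy => Vx; have [_ [[k _ <-] Bx BV]] := bB _ x (cf V oV) Vx.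
  by exists (f @` B k); split; [exists k|exists x|move=> _ [z /BV Vz <-]].
- by move=> n k l /sub_B; exact: image_subset.
- move=> n k V y oV + [x Bx xy]; rewrite -xy => Vx.
  have [l [Rkl Blx BV]] := refine n k _ x (cf V oV) Vx Bx.
  by exists l; split; [|exists x|move=> _ [z /BV Vz <-]].
- move=> s /chain_cvg[x xs xlim]; exists (f x) => [n|V oV Vx].
    by exists x; first exact: xs.
  have [n BV] := xlim _ (cf V oV) Vx.
  by exists n => _ [z /BV Vz <-].
Qed.

End has_convergent_base.

Lemma homeomorphic_has_convergent_base (S T : topologicalType) :
  homeomorphic S T -> has_convergent_base T -> has_convergent_base S.
Proof.
move=> [f [g [fK gK /continuousP cf cg]]].
apply: (has_convergent_base_image cg).
  move=> U oU; suff -> : g @` U = f @^-1` U by exact: cf.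
  apply/seteqP; split=> [_ [y Uy <-]|x Ux]; first by rewrite /= gK.
  by exists (f x).
by apply/seteqP; split=> // x _; exists (f x).
Qed.

Lemma has_convergent_base_prod (S T : topologicalType) :
  has_convergent_base S -> has_convergent_base T ->
  has_convergent_base (S * T)%type.
Proof.
move=> [K [B [R cbS]]] [L [C [Q cbT]]].
have [/basisP[oB bB] sub_B refB cvgB] := cbS.
have [/basisP[oC bC] sub_C refC cvgC] := cbT.
exists (K * L)%type, (fun k => B k.1 `*` C k.2).
exists (fun n k l => R n k.1 l.1 /\ Q n k.2 l.2); split.
- apply/basisP; split=> [_ [k _ <-]|V p oV Vp].
    by apply: open_setX; [apply: oB; exists k.1|apply: oC; exists k.2].
  have [U [W [oU oW Up Wp UWV]]] := open_prod_box oV Vp.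
  have [_ [[k _ <-] Bp BU]] := bB U _ oU Up.
  have [_ [[l _ <-] Cp CW]] := bC W _ oW Wp.
  exists (B k `*` C l); split=> //; first by exists (k, l).
  by apply: subset_trans UWV; exact: setSX.
- by move=> n k l [/sub_B BB /sub_C CC]; exact: setSX.
- move=> n [k1 k2] V p oV Vp [Bp Cp].
  have [U [W [oU oW Up Wp UWV]]] := open_prod_box oV Vp.
  have [l1 [R1 B1p B1U]] := refB n k1 U _ oU Up Bp.
  have [l2 [Q2 C2p C2W]] := refC n k2 W _ oW Wp Cp.
  exists (l1, l2); split=> //.
  by apply: subset_trans UWV; exact: setSX.
move=> s chain_s.
have [chain1 chain2] := all_and2 chain_s.
have [x xs xlim] := cvgB _ chain1; have [y ys ylim] := cvgC _ chain2.
exists (x, y) => [n|V oV Vp]; first by split; [exact: xs|exact: ys].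
have [U [W [oU oW Ux Wy UWV]]] := open_prod_box oV Vp.
have [m BU] := xlim U oU Ux; have [n CW] := ylim W oW Wy.
exists (maxn m n); apply: subset_trans UWV; apply: setSX.
  apply: subset_trans CW.
  exact: (convergent_base_chain (s := snd \o s) cbT chain2 (leq_maxr m n)).
apply: subset_trans BU.
exact: (convergent_base_chain (s := fst \o s) cbS chain1 (leq_maxl m n)).
Qed.

Lemma Pi02P (T : topologicalType) (A : set T) : Pi02 A <->
  exists U V : nat -> set T, [/\ forall n, open (U n), forall n, open (V n)
    & A = [set x | forall n, U n x -> V n x]].
Proof.
have UV_C (U V : nat -> set T) :
    ~` (\bigcup_n (U n `\` V n)) = [set x | forall n, U n x -> V n x].
  apply/seteqP; split=> x nUV; last by case=> n _ [Ux]; apply; exact: nUV.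
  by move=> n Ux; apply: contrapT => nVx; apply: nUV; exists n.
split=> -[U [V [oU oV AE]]]; exists U, V; split=> //.
  by rewrite -UV_C -AE setCK.
by rewrite AE -UV_C setCK.
Qed.

Lemma has_convergent_base_Pi02 (T : topologicalType) (A : set T) :
  Pi02 A -> has_convergent_base T -> has_convergent_base (set_type A).
Proof.
move=> /Pi02P[U [V [oU oV AE]]] [K [B [R cbT]]].
have [/basisP[oB bB] sub_B refine chain_cvg] := cbT.
exists K, (fun k => set_val @^-1` B k).
exists (fun n k l => R n k l /\
  forall i : 'I_n.+1, B k `<=` U i -> B l `<=` V i); split.
- apply/basisP; split=> [_ [k _ <-]|_ x [W oW <-] Wx].
    by exists (B k) => //; apply: oB; exists k.
  have [_ [[k _ <-] Bx BW]] := bB W _ oW Wx.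
  by exists (set_val @^-1` B k); split=> // y; exact: BW.
- by move=> n k l [/sub_B BB _] x; exact: BB.
- move=> n k _ x [W oW <-] Wx Bx.
  have : nbhs (set_val x)
      [set y | W y /\ forall i : 'I_n.+1, B k `<=` U i -> V i y].
    apply: filterI; first exact: open_nbhs_nbhs.
    apply: filter_forall => i.
    have [BU|nBU] := pselect (B k `<=` U i); last exact: filterE.
    have Vx : V i (set_val x).
      by have := set_valP x; rewrite {1}AE; apply; exact: BU.
    by apply: (filterS (P := V i)) => //; exact: open_nbhs_nbhs.
  rewrite nbhsE => -[N [oN Nx] NUV].
  have [l [Rkl Blx BN]] := refine n k N _ oN Nx Bx.
  exists l; split=> //; last by move=> y /BN/NUV[].
  by split=> // i BU y /BN/NUV[_]; exact.
move=> s chain_s.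
have [chainR chainUV] := all_and2 chain_s.
have [x xs xlim] := chain_cvg s chainR.
have Ax : A x.
  rewrite AE => i Ux; have [n BU] := xlim _ (oU i) Ux.
  have lt_i : (i < (maxn n i).+1)%N by rewrite ltnS leq_maxr.
  apply: (chainUV (maxn n i) (Ordinal lt_i)) (xs _) => /=.
  exact: subset_trans (convergent_base_chain cbT chainR (leq_maxl n i)) BU.
exists (exist _ x (mem_set Ax)) => [n|_ [W oW <-] Wx]; first exact: xs.
by have [n BW] := xlim W oW Wx; exists n => y; exact: BW.
Qed.

(** * Polish spaces *)

Lemma separable_dense_range (T : topologicalType) : separable_space T ->
  exists (K : countType) (c : K -> T), dense (range c).
Proof.
move=> [D cD dense_D].
have [K DK] : {K : countType | set_type D = K :> Type}.
  by apply: Pcountable; rewrite (eq_countable (card_setT _)).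
suff : exists c : set_type D -> T, dense (range c) by rewrite DK; exists K.
exists set_val => V V0 oV; have [x [Vx Dx]] := dense_D V V0 oV.
by exists x; split=> //; exists (exist _ x (mem_set Dx)).
Qed.

Section metric.
Context {R : realType} {T : topologicalType} (d : T -> T -> R).
Hypotheses (dm : is_metric d) (dT : metrizes d).
Local Open Scope ring_scope.

Lemma metric_ball_open x r : open [set y | d x y < r].
Proof.
case: dm => _ _ _ d_triangle; rewrite openE => y /= xy; rewrite /interior dT.
exists (r - d x y); first by rewrite /=; lra.
by move=> z /= yz; have := d_triangle x y z; lra.
Qed.

Lemma metric_openP V x : open V -> V x ->
  exists2 e : R, 0 < e & [set y | d x y < e] `<=` V.
Proof.
move=> oV Vx; have : nbhs x V by exact: open_nbhs_nbhs.
by rewrite dT => -[e /= e0 eV]; exists e.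
Qed.

Lemma metric_ball_center x r : 0 < r -> [set y | d x y < r] x.
Proof. by case: dm => _ d_eq0 _ _ /=; rewrite (d_eq0 x x).2. Qed.

Lemma nested_balls_cvg (c : nat -> T) (r : nat -> R) : complete_metric d ->
  (forall n, 0 < r n) -> r @ \oo --> 0 ->
  (forall n, [set y | d (c n.+1) y <= r n.+1] `<=` [set y | d (c n) y < r n]) ->
  exists2 x, forall n, d (c n) x < r n &
    forall V, open V -> V x -> exists n, [set y | d (c n) y < r n] `<=` V.
Proof.
case: dm => _ _ d_sym d_triangle dc r_gt0 r_cvg nested.
have r_small e : 0 < e -> exists n, r n < e.
  move=> e0; have [N _ rN] : \forall n \near \oo, r n < e.
    exact: cvgr_lt r_cvg _ e0.
  by exists N; exact: (rN N (leqnn N)).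
have center_in m n : (m <= n)%N -> d (c m) (c n) < r m.
  move=> mn; suff : [set y | d (c n) y < r n] `<=` [set y | d (c m) y < r m].
    by apply; exact: metric_ball_center.
  apply: (nonincreasing_sets (F := fun k => [set y | d (c k) y < r k])) mn => i.
  by apply: subset_trans (nested i) => y /ltW.
have [|x cx] := dc c.
  move=> e e0; have [|N rN] := r_small (e / 2); first lra.
  exists N => m n /center_in Nm /center_in Nn.
  by have := d_triangle (c m) (c N) (c n); rewrite (d_sym (c m) (c N)); lra.
have x_le n : d (c n) x <= r n.
  apply/ler_addgt0Pr => e e0.
  have /cx[N _ /= cN] : nbhs x [set y | d x y < e] by rewrite dT; exists e.
  have := center_in n (maxn n N) (leq_maxl _ _).
  have /= := cN (maxn n N) (leq_maxr _ _); rewrite (d_sym x).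
  by have := d_triangle (c n) (c (maxn n N)) x; lra.
have x_lt n : d (c n) x < r n by apply: nested; exact: x_le.
exists x => // V oV Vx; have [e e0 eV] := metric_openP oV Vx.
have [|n rn] := r_small (e / 2); first lra.
exists n => y /= cy; apply: eV => /=; have := x_lt n; rewrite d_sym.
by have := d_triangle x (c n) y; lra.
Qed.

Section dense_balls.
Context {K : countType} (c : K -> T).
Hypothesis dense_c : dense (range c).

Definition dense_ball (k : K * nat) : set T :=
  [set y | d (c k.1) y < harmonic k.2].

Definition closed_dense_ball (k : K * nat) : set T :=
  [set y | d (c k.1) y <= harmonic k.2].

Lemma small_dense_ball n V x : open V -> V x -> exists k,
  [/\ (n <= k.2)%N, dense_ball k x & closed_dense_ball k `<=` V].
Proof.
case: (dm) => _ _ d_sym d_triangle oV Vx; have [e e0 eV] := metric_openP oV Vx.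
have [N _ NP] : \forall m \near \oo, harmonic m < e / 2.
  by apply: cvgr_lt; [exact: cvg_harmonic|lra].
pose m := maxn n N; have m_small : harmonic m < e / 2 := NP m (leq_maxr n N).
have open_xm := metric_ball_open x (harmonic m).
have [|_ [/[swap] [[i _ <-]] /= xi]] := dense_c _ open_xm.
  by exists x; apply: metric_ball_center; exact: harmonic_gt0.
exists (i, m); split; first exact: leq_maxl.
  by rewrite /dense_ball /= d_sym.
move=> y iy; apply: eV; apply: (le_lt_trans (d_triangle x (c i) y)).
by rewrite [ltRHS]splitr ltrD// ?(lt_trans xi)// (le_lt_trans iy).
Qed.

Lemma dense_ball_convergent_base : complete_metric d ->
  convergent_base dense_ball
    (fun n k l => (n <= l.2)%N /\ closed_dense_ball l `<=` dense_ball k).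
Proof.
have open_ball k : open (dense_ball k) by exact: metric_ball_open.
have sub_closed k : dense_ball k `<=` closed_dense_ball k by move=> y /ltW.
move=> dc; split.
- apply/basisP; split=> [_ [k _ <-] //|V x oV Vx].
  have [k [_ xk kV]] := small_dense_ball 0 oV Vx.
  by exists (dense_ball k); split; [exists k| |exact: subset_trans kV].
- by move=> n k l [_]; exact: subset_trans.
- move=> n k V x oV Vx kx.
  have [l [nl lx]] := small_dense_ball n (openI oV (open_ball k)) (conj Vx kx).
  rewrite subsetI => -[lV lk].
  by exists l; split=> //; exact: subset_trans lV.
move=> s chain_s.
apply: (nested_balls_cvg (c := c \o (fst \o s)) (r := harmonic \o (snd \o s)))
  => //.
- by move=> n; exact: harmonic_gt0.
- apply: (cvg_comp _ _ _ cvg_harmonic).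
  move=> P [N _ NP]; exists N.+1 => // -[//|n] Nn; apply: NP => /=.
  exact: leq_trans (chain_s n).1.
- by move=> n; exact: (chain_s n).2.
Qed.

End dense_balls.

End metric.

Lemma polish_has_convergent_base (R : realType) (T : topologicalType) :
  polish R T -> has_convergent_base T.
Proof.
move=> [/separable_dense_range[K [c dense_c]] [d [dm dT dc]]].
exists (K * nat)%type, (dense_ball d c); eexists.
exact: dense_ball_convergent_base.
Qed.

(** * Quasi-Polish spaces *)

Section Pi02.
Context {T : topologicalType}.
Implicit Types A U V : set T.

Lemma Pi02_imply U V : open U -> open V -> Pi02 [set x | U x -> V x].
Proof.
move=> oU oV; apply/Pi02P; exists (fun=> U), (fun=> V); split=> //.
by apply/seteqP; split=> x UV; [move=> _|exact: (UV 0%N)].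
Qed.

Lemma open_Pi02 U : open U -> Pi02 U.
Proof.
move=> oU; suff -> : U = [set x | setT x -> U x] by exact: Pi02_imply openT oU.
by apply/seteqP; split=> x Ux; [move=> _|exact: Ux].
Qed.

Lemma closed_Pi02 A : closed A -> Pi02 A.
Proof.
move=> /closed_openC oA.
suff -> : A = [set x | (~` A) x -> set0 x] by exact: Pi02_imply oA open0.
by rewrite -[LHS]setCK.
Qed.

Lemma Pi02_bigcap (I : Type) (D : set I) (A : I -> set T) :
  countable D -> (forall i, D i -> Pi02 (A i)) -> Pi02 (\bigcap_(i in D) A i).
Proof.
move=> /countable_range[->|[f ->]] PiA.
  by rewrite bigcap_set0; exact/open_Pi02/openT.
have /choice[UV UVP] : forall n, exists UV : (nat -> set T) * (nat -> set T),
    [/\ forall m, open (UV.1 m), forall m, open (UV.2 m)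
      & A (f n) = [set x | forall m, UV.1 m x -> UV.2 m x]].
  by move=> n; have [|U [V [oU oV AE]]] := (Pi02P (A (f n))).1 (PiA _ _);
    [exists n|exists (U, V)].
apply/Pi02P.
exists (fun k => if unpickle k is Some (n, m) then (UV n).1 m else set0).
exists (fun k => if unpickle k is Some (n, m) then (UV n).2 m else set0).
split.
- by move=> k; case: unpickle => [[n m]|]; [case: (UVP n)|exact: open0].
- by move=> k; case: unpickle => [[n m]|]; [case: (UVP n)|exact: open0].
rewrite bigcap_image; apply/seteqP; split=> x Ax.
  move=> k; case: unpickle => [[n m]|//].
  have : A (f n) x by exact: Ax.
  by have [_ _ ->] := UVP n; exact.
move=> n _; rewrite /=; have [_ _ ->] := UVP n.
by move=> m; have := Ax (pickle (n, m)); rewrite pickleK.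
Qed.

Lemma Pi02I A B : Pi02 A -> Pi02 B -> Pi02 (A `&` B).
Proof.
move=> PiA PiB; rewrite -bigcap2E; apply: Pi02_bigcap => [|[|[|n]] _ //=].
  exact: countableP.
exact/open_Pi02/openT.
Qed.

End Pi02.

Lemma embedding_homeomorphic (S T : topologicalType) (e : S -> T) :
  kolmogorov_space S -> continuous e ->
  (forall U, open U -> exists2 V, open V & U = e @^-1` V) ->
  homeomorphic S (set_type (range e)).
Proof.
move=> /kolmogorov_spaceP T0 /continuousP ce lift_open.
have e_inj x y : e x = e y -> x = y.
  by move=> exy; apply: T0 => _ /lift_open[V _ ->]; rewrite /= exy.
have /choice[h hK] : forall y : range e, exists x, e x = \val y.
  by move=> y; have [x _ xy] := set_valP y; exists x.
pose f x : range e := exist _ (e x) (mem_set (imageT e x)).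
exists f, h; split.
- by move=> x; apply: e_inj; rewrite hK.
- by move=> y; apply: val_inj; rewrite /= hK.
- by apply/continuousP => _ [V oV <-]; exact: ce.
- apply/continuousP => _ /lift_open[V oV ->]; exists V => //.
  by apply/seteqP; split=> y /=; rewrite hK.
Qed.

Lemma nbhs_bigcap_fset (T : topologicalType) (I : choiceType) (F : {fset I})
    (U : I -> set T) (x : T) :
  (forall i, open (U i)) -> (forall i, i \in F -> U i x) ->
  nbhs x (\bigcap_(i in [set` F]) U i).
Proof.
by move=> oU Ux; apply: filter_bigI => i Fi;
  apply: open_nbhs_nbhs; split; [exact: oU|exact: Ux].
Qed.

Section sierpinski_power.
Local Notation SN := {ptws nat -> sierpinski}.

Definition cylinder (F : {fset nat}) : set SN :=
  \bigcap_(n in [set` F]) [set b | b n].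

Lemma open_coordinate n : open [set b : SN | b n].
Proof.
have /continuousP/(_ [set true]) : continuous (fun b : SN => b n).
  exact: (@proj_continuous nat (fun=> sierpinski) n).
by apply.
Qed.

Lemma open_cylinder F : open (cylinder F).
Proof.
by rewrite openE => b Fb; apply: nbhs_bigcap_fset => //; exact: open_coordinate.
Qed.

Lemma cylinder_basis : basis (range cylinder).
Proof.
split=> [_ [F _ <-]|b]; first exact: open_cylinder.
have cylinder_filter : Filter (filter_from [set F | cylinder F b] cylinder).
  apply: filter_from_filter; first by exists fset0 => n; rewrite /= inE.
  move=> F1 F2 F1b F2b; exists (F1 `|` F2)%fset.
    by move=> n /=; rewrite inE => /orP[/F1b|/F2b].
  by move=> a Fa; split=> n /= Fn; apply: Fa; rewrite /= inE Fn ?orbT.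
have : filter_from [set F | cylinder F b] cylinder --> b.
  apply/cvg_sup => n A [_ [[N oN <-] /= Nb NA]].
  have [bn|nbn] := boolP (b n).
    exists [fset n]%fset; first by move=> m /=; rewrite inE => /eqP->.
    move=> a Fa; apply: NA => /=.
    have -> // : a n = b n by rewrite bn; apply: Fa; rewrite /= inE.
  exists fset0 => [m|a _]; first by rewrite /= inE.
  apply: NA => /=; rewrite (negbTE nbn) in Nb.
  by case: (a n) => //; exact: oN.
by apply: cvg_trans => A [F Fb FA]; exists (cylinder F).
Qed.

Lemma continuous_coordinates (T : topologicalType) (e : T -> SN) :
  (forall n, open [set x | e x n]) -> continuous e.
Proof.
move=> oe; apply/continuousP => V oV; rewrite openE => x Vx.
have /basisP[_ /(_ V _ oV Vx)[_ [[F _ <-] Fx FV]]] := cylinder_basis.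
have := nbhs_bigcap_fset (F := F) oe Fx.
by apply: filterS => y Fy; exact: FV.
Qed.

Lemma Pi02_support (D : set nat) : Pi02 [set b : SN | [set n | b n] `<=` D].
Proof.
have -> : [set b : SN | [set n | b n] `<=` D] =
    \bigcap_(n in ~` D) ~` [set b | b n].
  apply/seteqP; split=> b bD n => [nD /bD//|bn].
  by apply: contrapT => /bD; exact.
apply: Pi02_bigcap => [|n _]; first exact: countableP.
exact/closed_Pi02/open_closedC/open_coordinate.
Qed.

Lemma sierpinski_power_convergent_base :
  convergent_base cylinder (fun _ F F' => {subset F <= F'}).
Proof.
have /basisP[_ bF] := cylinder_basis.
split; first exact: cylinder_basis.
- by move=> _ F F' FF' b F'b n Fn; apply: F'b; exact: FF'.
- move=> _ F V b oV Vb Fb; have [_ [[F' _ <-] F'b F'V]] := bF V b oV Vb.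
  exists (F `|` F')%fset; split.
  + by move=> n Fn; rewrite inE Fn.
  + by move=> n /=; rewrite inE => /orP[/Fb|/F'b].
  + move=> a FF'a; apply: F'V => n /= F'n.
    by apply: FF'a; rewrite /= inE F'n orbT.
move=> F incr_F.
have subF m n : (m <= n)%N -> {subset F m <= F n}.
  move: m n; apply: (@homo_leq _ F (fun F F' => {subset F <= F'})) => //.
    by move=> F' i.
  by move=> F2 F1 F3 F12 F23 i /F12/F23.
pose b : SN := fun i => `[< exists n, i \in F n >].
exists b => [n i Fi|V oV Vb]; first by apply/asboolP; exists n.
have [_ [[F' _ <-] F'b F'V]] := bF V b oV Vb.
have /choice[N NP] : forall i, exists n, i \in F' -> i \in F n.
  move=> i; have [/F'b/asboolP[n Fi]|] := boolP (i \in F'); first by exists n.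
  by exists 0%N.
exists (\max_(i <- F') N i)%N => a Fa; apply: F'V => i F'i; apply: Fa => /=.
by apply: subF (NP i F'i); exact: leq_bigmax_seq.
Qed.

End sierpinski_power.

Section quasi_polish_of_convergent_base.
Context {T : topologicalType} {K : countType}.
Variables (B : K -> set T) (R : nat -> K -> K -> Prop).
Hypothesis cbT : convergent_base B R.
Local Notation SN := {ptws nat -> sierpinski}.

Definition convergent_filter (a : set K) :=
  [/\ a !=set0,
      forall n k l, a k -> a l -> exists m, [/\ a m, R n k m & B m `<=` B l]
    & forall k l, B k `<=` B l -> a k -> a l].

Lemma nbhs_convergent_filter (x : T) : convergent_filter [set k | B k x].
Proof.
have [/basisP[oB bB] sub_B refine _] := cbT.
split.
- by have [_ [[k _ <-] Bx _]] := bB setT x openT I; exists k.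
- move=> n k l Bk Bl; have oBl : open (B l) by apply: oB; exists l.
  by have [m [Rkm Bm Bml]] := refine n k _ x oBl Bl Bk; exists m.
- by move=> k l; exact.
Qed.

Lemma convergent_filter_chain (a : set K) : convergent_filter a ->
  exists s : nat -> K, [/\ forall n, a (s n), forall n, R n (s n) (s n.+1)
    & forall k, a k -> exists n, B (s n) `<=` B k].
Proof.
move=> [[k0 ak0] directed _].
have [|n k ak|s _ sP] := @countable_dependent_choice K a k0 (fun n k m =>
    R n k m /\ forall l, unpickle n = Some l -> a l -> B m `<=` B l) => //.
  have [[l [nl al]]|no_l] := pselect (exists l, unpickle n = Some l /\ a l).
    have [m [am Rkm Bml]] := directed n k l ak al; exists m => //.
    by split=> // l'; rewrite nl => -[<-].
  have [m [am Rkm _]] := directed n k k ak ak; exists m => //.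
  by split=> // l nl al; case: no_l; exists l.
exists s; split=> [n|n|k ak]; [exact: (sP n).1|exact: (sP n).2.1|].
exists (pickle k).+1; have [_ [_ sub_k]] := sP (pickle k).
by apply: sub_k => //; exact: pickleK.
Qed.

Lemma convergent_filterP (a : set K) :
  convergent_filter a <-> exists x, a = [set k | B k x].
Proof.
have [/basisP[oB _] _ _ chain_cvg] := cbT.
split=> [fa|[x ->]]; last exact: nbhs_convergent_filter.
have [_ _ up_a] := fa.
have [s [s_a chain_s below_s]] := convergent_filter_chain fa.
have [x xs xlim] := chain_cvg s chain_s.
exists x; apply/seteqP; split=> k /= => [/below_s[n sub_k]|Bk].
  exact: sub_k (xs n).
have [|n BB] := xlim (B k) _ Bk; first by apply: oB; exists k.
exact: up_a BB (s_a n).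
Qed.

Definition base_code (x : T) : SN :=
  fun n => `[< exists2 k, pickle k = n & B k x >].

Lemma base_code_pickle (x : T) (k : K) : base_code x (pickle k) = `[< B k x >].
Proof.
apply: asbool_equiv_eq; split=> [[l /(pcan_inj pickleK)->//]|Bx].
by exists k.
Qed.

Lemma continuous_base_code : continuous base_code.
Proof.
have [/basisP[oB _] _ _ _] := cbT.
apply: continuous_coordinates => n.
have -> : [set x | base_code x n] = \bigcup_(k in [set k | pickle k = n]) B k.
  by apply/seteqP; split=> x => [/asboolP|?]; last exact/asboolP.
by apply: bigcup_open => k _; apply: oB; exists k.
Qed.

Lemma base_code_lift_open (U : set T) : open U ->
  exists2 V : set SN, open V & U = base_code @^-1` V.
Proof.
have [/basisP[_ bB] _ _ _] := cbT.
move=> oU; exists (\bigcup_(k in [set k | B k `<=` U]) [set b | b (pickle k)]).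
  by apply: bigcup_open => k _; exact: open_coordinate.
apply/seteqP; split=> [x /(bB _ _ oU)[_ [[k _ <-] Bx BU]]|x [k BU]] /=.
  by exists k => //=; rewrite base_code_pickle; exact/asboolP.
by rewrite base_code_pickle => /asboolP/BU.
Qed.

Lemma range_base_code : range base_code =
  [set b | convergent_filter [set k | b (pickle k)]] `&`
  [set b | [set n | b n] `<=` range (@pickle K)].
Proof.
apply/seteqP; split=> [_ [x _ <-]|b [/convergent_filterP[x bx] b_pickle]].
  split=> [|n /asboolP[k <- _]]; last by exists k.
  rewrite /=; have -> : [set k | base_code x (pickle k)] = [set k | B k x].
    by apply/funext => k /=; rewrite base_code_pickle asboolE.
  exact: nbhs_convergent_filter.
exists x => //; apply/funext => n; apply/idP/idP.
  move=> /asboolP[k <- Bx].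
  by rewrite -[is_true _]/([set k | b (pickle k)] k) bx.
move=> bn; have [k _ kn] := b_pickle n bn.
rewrite -kn base_code_pickle; apply/asboolP.
by rewrite -[B k x]/([set k | B k x] k) -bx /= kn.
Qed.

Lemma Pi02_convergent_filter :
  Pi02 [set b : SN | convergent_filter [set k | b (pickle k)]].
Proof.
pose O (k : K) : set SN := [set b | b (pickle k)].
have oO k : open (O k) := open_coordinate (pickle k).
have -> : [set b : SN | convergent_filter [set k | b (pickle k)]] =
    (\bigcup_k O k) `&`
    ((\bigcap_(p in [set: nat * K * K]) [set b | (O p.1.2 `&` O p.2) b ->
       (\bigcup_(m in [set m | R p.1.1 p.1.2 m /\ B m `<=` B p.2]) O m) b]) `&`
     (\bigcap_(p in [set p : K * K | B p.1 `<=` B p.2])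
       [set b | O p.1 b -> O p.2 b])).
  apply/seteqP; split=> b.
    move=> [[k bk] directed up]; split; first by exists k.
    split=> [[[n k'] l] _ [bk' bl]|[k' l] /= kl]; last exact: up.
    by have [m [bm Rkm Bml]] := directed n k' l bk' bl; exists m.
  move=> [[k _ bk] [directed up]]; split; first by exists k.
    move=> n k' l bk' bl.
    by have [m [Rkm Bml] bm] := directed (n, k', l) I (conj bk' bl); exists m.
  by move=> k' l kl; exact: (up (k', l)).
apply: Pi02I; first by apply: open_Pi02; exact: bigcup_open.
apply: Pi02I; apply: Pi02_bigcap => [|p _]; do ?exact: countableP.
  by apply: Pi02_imply; [exact: openI|exact: bigcup_open].
exact: Pi02_imply.
Qed.

Lemma Pi02_range_base_code : Pi02 (range base_code).
Proof.
rewrite range_base_code; apply: Pi02I; first exact: Pi02_convergent_filter.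
exact: Pi02_support.
Qed.

End quasi_polish_of_convergent_base.

Lemma quasi_polishP (T : topologicalType) :
  quasi_polish T <-> kolmogorov_space T /\ has_convergent_base T.
Proof.
split=> [[A [PiA homeo_A]]|[T0 [K [B [R cbT]]]]].
  split; last first.
    apply: homeomorphic_has_convergent_base homeo_A _.
    apply: has_convergent_base_Pi02 PiA _; do 3 eexists.
    exact: sierpinski_power_convergent_base.
  have [f [g [fK _ cf _]]] := homeo_A.
  have /continuousP cvf : continuous (set_val \o f).
    by move=> x; apply: continuous_comp (cf x) _; exact: initial_continuous.
  apply/kolmogorov_spaceP => x y xy; apply: (can_inj fK); apply: val_inj.
  apply/funext => n; have xy_n := xy _ (cvf _ (open_coordinate n)).
  by apply/idP/idP => /xy_n.
exists (range (base_code B)); split; first exact: Pi02_range_base_code cbT.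
apply: embedding_homeomorphic => //; first exact: continuous_base_code cbT.
exact: base_code_lift_open cbT.
Qed.

(** * Vaught transforms *)

Section topological_group.
Context {G : topologicalGroupType}.
Implicit Types (g h : G) (U : set G).

Lemma mulg_continuousr g : continuous (fun h : G => (g * h)%g).
Proof.
move=> h.
apply: (@continuous_comp _ _ _ (fun h => (g, h)) (fun p => p.1 * p.2)%g).
  by apply: cvg_pair => //=; exact: cvg_cst.
exact: mulg_continuous.
Qed.

Lemma open_translate g U : open U -> open [set h | U (g * h)%g].
Proof. by move: U; apply/continuousP/mulg_continuousr. Qed.

Lemma mulg_open_mapr g : open_map (fun h : G => (g * h)%g).
Proof.
move=> U oU; suff -> : [set (g * h)%g | h in U] = [set h | U (g^-1 * h)%g].
  exact: open_translate.
apply/seteqP; split=> [_ [h Uh <-]|h Uh] /=; first by rewrite mulKg.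
by exists (g^-1 * h)%g; rewrite ?mulVKg.
Qed.

Lemma open_mulg U g h : open U -> U (g * h)%g ->
  exists V W, [/\ open V, open W, V g, W h &
    forall v w, V v -> W w -> U (v * w)%g].
Proof.
move=> oU Ugh; have /continuousP/(_ U oU) openU := @mulg_continuous G.
have [V [W [oV oW Vg Wh VWU]]] := open_prod_box (p := (g, h)) openU Ugh.
by exists V, W; split=> // v w Vv Ww; exact: (VWU (v, w)).
Qed.

Lemma continuous_invg_pair (T : topologicalType) (x : T) :
  continuous (fun g : G => (g^-1%g, x)).
Proof.
by move=> g; apply: cvg_pair; [exact: invg_continuous|exact: cvg_cst].
Qed.

Lemma meager_translate g (A : set G) :
  meager [set h | A (g * h)%g] <-> meager A.
Proof.
have translate k B : meager B -> meager [set h : G | B (k * h)%g].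
  by apply: meager_preimage; [exact: mulg_continuousr|exact: mulg_open_mapr].
split=> [/(translate g^-1%g)|]; last exact: translate.
by apply: sub_meager => h /=; rewrite mulVKg.
Qed.

End topological_group.

Definition return_set (G : groupType) (X : Type) (alpha : G * X -> X)
    (A : set X) (x : X) : set G :=
  [set g | A (alpha (g^-1%g, x))].

Section vaught.
Context {G : topologicalGroupType} {X : Type} {alpha : G * X -> X}.
Hypothesis alphaA : left_action alpha.
Implicit Types (g h : G) (x y : X) (U V W : set G) (A B : set X).

Lemma actK g : cancel (fun x => alpha (g, x)) (fun x => alpha (g^-1%g, x)).
Proof. by move=> x; rewrite -alphaA.2 mulVg alphaA.1. Qed.

Lemma actVK g : cancel (fun x => alpha (g^-1%g, x)) (fun x => alpha (g, x)).
Proof. by move=> x; rewrite -alphaA.2 mulgV alphaA.1. Qed.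

Lemma vaughtE U A x :
  vaught alpha U A x <-> ~ meager (return_set alpha A x `&` U).
Proof.
rewrite /vaught /=; set S := [set g | _].
suff -> : S = return_set alpha A x `&` U by [].
apply/seteqP; split=> g.
  by move=> [Ug [a Aa <-]]; split=> //; rewrite /return_set /= actK.
by move=> [Ag Ug]; split=> //; exists (alpha (g^-1%g, x)); rewrite // actVK.
Qed.

Lemma sub_vaught U V A B : U `<=` V -> A `<=` B ->
  vaught alpha U A `<=` vaught alpha V B.
Proof.
move=> UV AB x /vaughtE nU; apply/vaughtE => mV; apply: nU.
by apply: sub_meager mV => g [/AB Ag /UV].
Qed.

Lemma vaught_act U A g x :
  vaught alpha U A (alpha (g, x)) <-> vaught alpha [set h | U (g * h)%g] A x.
Proof.
rewrite !vaughtE -(meager_translate g).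
suff -> : [set h | (return_set alpha A (alpha (g, x)) `&` U) (g * h)%g] =
    return_set alpha A x `&` [set h | U (g * h)%g] by [].
by apply/seteqP; split=> h [Ah Uh]; split=> //;
  move: Ah; rewrite /return_set /= -alphaA.2 invgM mulgVK.
Qed.

Lemma vaught_hit U A x : vaught alpha U A x ->
  exists2 g, U g & A (alpha (g^-1%g, x)).
Proof. by move=> /vaughtE/nonmeager_nonempty[g [Ag Ug]]; exists g. Qed.

Lemma locally_nonmeager_vaught U A x g : open U -> U g ->
  locally_nonmeager (return_set alpha A x) g -> vaught alpha U A x.
Proof. by move=> oU Ug lg; apply/vaughtE; exact: lg. Qed.

Lemma open_return_vaught U W A x : baire_space G -> open W -> W !=set0 ->
  W `<=` U `&` return_set alpha A x -> vaught alpha U A x.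
Proof.
move=> baireG oW W0 WUA; apply/vaughtE => mA; apply: (baireG W oW W0).
by apply: sub_meager mA => g /WUA[].
Qed.

(* With k a point of local nonmeagerness of [return_set alpha A (alpha (g, x))],
   take W and C to be neighbourhoods of g and g^-1 k with W C in U. *)
Lemma vaught_act_nbhs U A g x : @second_countable G -> open U ->
  vaught alpha U A (alpha (g, x)) ->
  exists W C, [/\ open W, W g, open C, vaught alpha C A x &
    forall w y, W w -> vaught alpha C A y -> vaught alpha U A (alpha (w, y))].
Proof.
move=> scG oU /vaughtE/(nonmeager_locally_nonmeager scG)[k [[_ Uk] lk]].
have [|W [C [oW oC Wg Ck WC]]] := @open_mulg _ U g (g^-1 * k)%g oU.
  by rewrite mulVKg.
exists W, C; split=> //.
  have -> : C = [set h | C (g^-1 * (g * h))%g].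
    by apply/seteqP; split=> h /=; rewrite mulKg.
  apply/(vaught_act [set h | C (g^-1 * h)%g]).
  apply: (@locally_nonmeager_vaught _ _ _ k) => //; first exact: open_translate.
  by move=> V oV Vk mAV; apply: (lk V oV Vk); apply: sub_meager mAV => h [[]].
move=> w y Ww Cy; apply/vaught_act.
by apply: sub_vaught Cy => // c Cc; exact: WC.
Qed.

End vaught.

Lemma continuous_borel_map (S T : topologicalType) (f : S -> T) :
  continuous f -> borel_map f.
Proof.
move=> /continuousP cf.
suff sub_image : @borel T `<=` image_set_system setT f (@borel S).
  by move=> A /sub_image; rewrite /image_set_system /= setTI.
apply: smallest_sub => [|U oU].
  exact/sigma_algebra_image/smallest_sigma_algebra.
by rewrite /image_set_system /= setTI; apply: sub_sigma_algebra; exact: cf.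
Qed.

Definition vaught_opens (G X : topologicalType) (alpha : G * X -> X) :
    set (set X) :=
  [set B | exists U A, [/\ open U, open A & B = vaught alpha U A]].

Section vaught_topology.
Context {G : topologicalGroupType} {X : topologicalType} {alpha : G * X -> X}.
Hypotheses (alphaA : left_action alpha).
Hypotheses (scG : @second_countable G) (scX : @second_countable X).
Hypothesis baireG : baire_space G.
Implicit Types (g h : G) (x y : X) (U V W : set G) (A B C : set X).

Local Notation OGOX := (vaught_unions alpha open open).

Lemma vaught_basis (D : set (set G)) (E : set (set X)) U A x :
  countable D -> basis D -> countable E -> basis E ->
  open U -> open A -> vaught alpha U A x ->
  exists V B, [/\ D V /\ E B, V `<=` U, B `<=` A & vaught alpha V B x].
Proof.
move=> cD /basisP[_ bD] cE /basisP[_ bE] oU oA /(vaughtE alphaA) nUA.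
pose P := [set p | (D `*` E) p /\ (p.1 `<=` U /\ p.2 `<=` A)].
have cP : countable P.
  by apply: subset_countable (countableX cD cE) => p [].
have coverP : return_set alpha A x `&` U `<=`
    \bigcup_(p in P) (return_set alpha p.2 x `&` p.1).
  move=> g [Ag Ug]; have [V [DV Vg VU]] := bD U g oU Ug.
  by have [B [EB Bg BA]] := bE A _ oA Ag; exists (V, B).
have [[V B] [[DV EB] [VU BA]] nVB] := nonmeager_bigcup cP coverP nUA.
by exists V, B; split=> //; exact/(vaughtE alphaA).
Qed.

Lemma vaught_unionsE : OGOX = union_closure (vaught_opens alpha).
Proof.
apply/seteqP; split=> [_ [I [U [A [oU oA ->]]]] x [i Ii Ux]|B BV].
  exists (vaught alpha (U i) (A i)); split=> // [|y Uy]; last by exists i.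
  by exists (U i), (A i); split; [exact: oU|exact: oA|].
have [[D cD basisD] [E cE basisE]] := (scG, scX).
pose P := [set p | (D `*` E) p /\ vaught alpha p.1 p.2 `<=` B].
have BP : B = \bigcup_(p in P) vaught alpha p.1 p.2.
  apply/seteqP; split=> x => [/BV[_ [[U [A [oU oA ->]]] Ux UB]]|[p [_]]];
    last exact.
  have [V [C [[DV EC] VU CA Vx]]] := vaught_basis cD basisD cE basisE oU oA Ux.
  exists (V, C) => //; split=> //=.
  by apply: subset_trans UB; exact: sub_vaught.
have /countable_range[P0|[f Pf]] : countable P.
  by apply: subset_countable (countableX cD cE) => p [].
  exists set0, (fun=> set0), (fun=> set0); split=> //.
  by rewrite BP P0 !bigcup_set0.
have Pfn n : P (f n) by rewrite Pf.
exists setT, (fst \o f), (snd \o f); split; last by rewrite BP Pf bigcup_image.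
- by move=> n _; apply: basisD.1; have [[]] := Pfn n.
- by move=> n _; apply: basisE.1; have [[]] := Pfn n.
Qed.

Lemma vaught_in_unions U A : open U -> open A -> OGOX (vaught alpha U A).
Proof.
by move=> oU oA; rewrite vaught_unionsE; apply: sub_union_closure; exists U, A.
Qed.

Lemma open_return_set_vaught U A x : open U ->
  open (return_set alpha (vaught alpha U A) x).
Proof.
move=> oU; rewrite openE => g Ug.
have [W [C [oW Wg _ Cx WC]]] := vaught_act_nbhs alphaA scG oU Ug.
have nW : nbhs g [set h : G | W h^-1%g].
  by apply: invg_continuous; exact: open_nbhs_nbhs.
by apply: filterS nW => h Wh; exact: WC.
Qed.

(* Small group elements move x inside the open set C = C1 * A1 `&` C2 * A2,
   and move C into U1 * A1 and U2 * A2; hence x belongs to (W1 `&` W2) * C,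
   which is contained in both. *)
Lemma vaught_opensI B1 B2 : OGOX `<=` open ->
  vaught_opens alpha B1 -> vaught_opens alpha B2 ->
  union_closure (vaught_opens alpha) (B1 `&` B2).
Proof.
move=> openV [U1 [A1 [oU1 oA1 ->]]] [U2 [A2 [oU2 oA2 ->]]] x.
rewrite -[x]alphaA.1 => -[U1x U2x].
have [W1 [C1 [oW1 W11 oC1 C1x WC1]]] := vaught_act_nbhs alphaA scG oU1 U1x.
have [W2 [C2 [oW2 W21 oC2 C2x WC2]]] := vaught_act_nbhs alphaA scG oU2 U2x.
pose C := vaught alpha C1 A1 `&` vaught alpha C2 A2.
exists (vaught alpha (W1 `&` W2) C); split.
- exists (W1 `&` W2), C; split=> //; first exact: openI.
  by apply: openI; apply: openV; exact: vaught_in_unions.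
- pose N := (W1 `&` W2) `&` (return_set alpha (vaught alpha C1 A1) x `&`
                             return_set alpha (vaught alpha C2 A2) x).
  rewrite alphaA.1; apply: (open_return_vaught alphaA (W := N)) => //.
  + by apply: openI; apply: openI => //; exact: open_return_set_vaught.
  + by exists 1%g; rewrite /N /return_set /= !invg1 !alphaA.1.
- move=> y /(vaught_hit alphaA)[g [W1g W2g] [C1y C2y]].
  by rewrite -(actVK alphaA g y); split; [exact: WC1|exact: WC2].
Qed.

Lemma vaught_unions_topology : OGOX `<=` open -> is_topology OGOX.
Proof.
move=> openV; rewrite vaught_unionsE; apply: union_closure_topology.
  move=> x; exists (vaught alpha setT setT).
    by exists setT, setT; split=> //; exact: openT.
  by apply: (open_return_vaught alphaA (W := setT)) => //;
    [exact: openT|exists 1%g].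
by move=> B1 B2; exact: vaught_opensI.
Qed.

(* The source and target topologies on X are presented by maps i and j, so
   that each of them may be the original or the generated one. *)
Lemma vaught_action_continuous (S T : topologicalType) (i : S -> X) (j : X -> T)
    (f : G * S -> T) :
  (forall g s, f (g, s) = j (alpha (g, i s))) ->
  (forall B, OGOX B -> open (i @^-1` B)) ->
  (forall N, open N -> OGOX (j @^-1` N)) ->
  continuous f.
Proof.
move=> fE ci cj; apply/continuousP => N /cj; rewrite vaught_unionsE openE.
move=> ON [g x]; rewrite /= fE => /ON[_ [[U [A [oU oA ->]]] Ux UN]].
have [W [C [oW Wg oC Cx WC]]] := vaught_act_nbhs alphaA scG oU Ux.
have oCA : open (i @^-1` vaught alpha C A).
  by apply: ci; exact: vaught_in_unions.
exists (W, i @^-1` vaught alpha C A) => /=.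
  by split; exact: open_nbhs_nbhs.
by move=> [w y] [Ww Cy]; rewrite /= fE; apply: UN; exact: WC.
Qed.

Lemma vaught_unions_continuous (topO : is_topology OGOX) :
  continuous (alpha : G * topologized topO -> topologized topO).
Proof.
pose Y : topologicalType := topologized topO.
exact: (vaught_action_continuous (i := id : Y -> X) (j := id : X -> Y)).
Qed.

Lemma vaught_unions_open_continuous : OGOX = open -> continuous alpha.
Proof.
by move=> OE; apply: (vaught_action_continuous (i := id) (j := id)) => // B;
  rewrite OE.
Qed.

Lemma continuous_open_return_set A x : continuous alpha -> open A ->
  open (return_set alpha A x).
Proof.
move=> calpha; move: A; apply/continuousP => g.
apply: (@continuous_comp _ _ _ (fun g => (g^-1%g, x)) alpha) (calpha _).
exact: continuous_invg_pair.
Qed.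

Lemma continuous_open_vaught U A : continuous alpha -> open U -> open A ->
  open (vaught alpha U A).
Proof.
move=> calpha oU oA; rewrite openE => x /(vaught_hit alphaA)[g Ug Ag].
have /continuousP/(_ A oA) openalpha := calpha.
have [V [W [oV oW Vg Wx VWA]]] := open_prod_box (p := (g^-1%g, x)) openalpha Ag.
have nW : nbhs x W by exact: open_nbhs_nbhs.
apply: filterS nW => y Wy.
apply: (open_return_vaught alphaA (W := U `&` return_set alpha A y)) => //.
  by apply: openI => //; exact: continuous_open_return_set.
by exists g; split=> //; exact: (VWA (_, _)).
Qed.

Lemma continuous_open_sub_vaught B : continuous alpha -> open B ->
  union_closure (vaught_opens alpha) B.
Proof.
move=> calpha oB x Bx.
have B1x : (alpha @^-1` B) (1%g, x) by rewrite /= alphaA.1.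
have /continuousP/(_ B oB) openalpha := calpha.
have [V [W [oV oW V1 Wx VWB]]] := open_prod_box openalpha B1x.
exists (vaught alpha V W); split; first by exists V, W.
  apply: (open_return_vaught alphaA (W := V `&` return_set alpha W x)) => //.
    by apply: openI => //; exact: continuous_open_return_set.
  by exists 1%g; split=> //; rewrite /return_set /= invg1 alphaA.1.
move=> y /(vaught_hit alphaA)[g Vg Wy].
by rewrite -(actVK alphaA g y); exact: (VWB (_, _)).
Qed.

Lemma continuous_vaught_unions : continuous alpha -> OGOX = open.
Proof.
move=> calpha; rewrite vaught_unionsE; apply/seteqP; split=> [|B oB].
  apply: union_closure_open => _ [U [A [oU oA ->]]].
  exact: continuous_open_vaught.
exact: continuous_open_sub_vaught.
Qed.

Lemma borel_return_set A x : borel_map alpha -> borel A ->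
  borel (return_set alpha A x).
Proof.
move=> balpha bA.
exact: (continuous_borel_map (@continuous_invg_pair G X x) (balpha A bA)).
Qed.

Lemma vaught_separates x y : borel_map alpha -> kolmogorov_space X ->
  (forall U A, open U -> open A ->
     (vaught alpha U A x <-> vaught alpha U A y)) -> x = y.
Proof.
move=> balpha T0X xy; have [D cD basisD] := scX; have [oD _] := basisD.
pose ret A z := return_set alpha A z.
have meager_diff z z' A : D A ->
    (forall U, open U -> vaught alpha U A z -> vaught alpha U A z') ->
    meager (ret A z `\` ret A z').
  move=> /oD oA zz'; have bA : borel A by exact: sub_sigma_algebra.
  apply: meager_borelD => //; [exact: borel_return_set..|].
  by move=> U oU /(vaughtE alphaA)/(zz' U oU)/(vaughtE alphaA).
have meager_diffs : meager (\bigcup_(A in D) (ret A x `+` ret A y)).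
  apply: meager_bigcup => // A DA.
  by apply: meagerU; apply: meager_diff => // U oU; apply xy => //; exact: oD.
have [g nDg] : exists g, ~ (\bigcup_(A in D) (ret A x `+` ret A y)) g.
  apply: contrapT => /forallNP all; apply: (baireG openT); first by exists 1%g.
  by apply: sub_meager meager_diffs => g _; apply: contrapT; exact: all.
rewrite -(actVK alphaA g x) -(actVK alphaA g y); congr (alpha (_, _)).
apply: (kolmogorov_basis_eq T0X basisD) => A DA.
by split=> Ag; apply: contrapT => nAg; apply: nDg; exists A => //; [left|right].
Qed.

End vaught_topology.

(** * Good points *)

(* The image of [U `*` (A `&` good_points alpha)] under the action is U * A, so
   the action restricts to an open map onto the topology of the U * A. *)
Definition good_points (G : topologicalGroupType) (X : topologicalType)
    (alpha : G * X -> X) : set X :=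
  [set x | forall U A, open U -> U 1%g -> open A -> A x -> vaught alpha U A x].

Section good_points.
Context {G : topologicalGroupType} {X : topologicalType} {alpha : G * X -> X}.
Hypothesis alphaA : left_action alpha.
Hypotheses (scG : @second_countable G) (scX : @second_countable X).
Implicit Types (g h : G) (x y : X) (U : set G) (A : set X).

Local Notation OGOX := (vaught_unions alpha open open).
Local Notation good := (good_points alpha).

Lemma good_points_vaught U A g x : open U -> U g -> open A -> A x -> good x ->
  vaught alpha U A (alpha (g, x)).
Proof.
move=> oU Ug oA Ax gx; apply/(vaught_act alphaA).
by apply: gx => //; [exact: open_translate|rewrite /= mulg1].
Qed.

Lemma meager_not_good_points x :
  meager [set g | ~ good (alpha (g^-1%g, x))].
Proof.
have [D cD /basisP[oD bD]] := scX.
pose ret A := return_set alpha A x.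
apply: (@sub_meager _ _
  (\bigcup_(A in D) (ret A `\` locally_nonmeager (ret A)))).
  move=> g /existsNP[U /existsNP[A]].
  move=> /not_implyP[oU /not_implyP[U1 /not_implyP[oA /not_implyP[Ag nV]]]].
  have [B [DB Bg BA]] := bD A _ oA Ag; exists B => //; split=> // lg; apply: nV.
  apply: (sub_vaught alphaA (subset_refl (A := U)) BA).
  apply/(vaught_act alphaA); apply: locally_nonmeager_vaught lg => //.
    exact: open_translate.
  by rewrite /= mulVg.
by apply: meager_bigcup => // A _; exact: meager_not_locally_nonmeager.
Qed.

Lemma vaught_hit_good_points U A x : vaught alpha U A x ->
  exists g, [/\ U g, A (alpha (g^-1%g, x)) & good (alpha (g^-1%g, x))].
Proof.
move=> /(vaughtE alphaA) nUA; apply: contrapT => /forallNP no_good; apply: nUA.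
apply: sub_meager (meager_not_good_points x) => g [Ag Ug] gg.
exact: (no_good g).
Qed.

Lemma Pi02_good_points : OGOX `<=` open -> Pi02 good.
Proof.
move=> openV; have [[D cD basisD] [E cE basisE]] := (scG, scX).
have [[oD _] [oE _]] := (basisD, basisE).
have -> : good = \bigcap_(p in [set p | (D `*` E) p /\ p.1 1%g])
    [set x | p.2 x -> vaught alpha p.1 p.2 x].
  apply/seteqP; split=> x gx.
    by move=> [U A] [[DU EA] U1] Ax; apply: gx => //; [exact: oD|exact: oE].
  move=> U A oU U1 oA Ax.
  have [_ /(_ U 1%g oU U1)[V [DV V1 VU]]] := (basisP D).1 basisD.
  have [_ /(_ A x oA Ax)[B [EB Bx BA]]] := (basisP E).1 basisE.
  exact: sub_vaught VU BA _ (gx (V, B) (conj (conj DV EB) V1) Bx).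
apply: Pi02_bigcap => [|[U A] [[/oD oU /oE oA] _]].
  by apply: subset_countable (countableX cD cE) => p [].
apply: Pi02_imply => //; apply: openV.
exact: vaught_in_unions.
Qed.

End good_points.

Section vaught_quasi_polish.
Context {G : topologicalGroupType} {X : topologicalType} {alpha : G * X -> X}.
Hypotheses (alphaA : left_action alpha) (balpha : borel_map alpha).
Hypotheses (cbG : has_convergent_base G) (qpX : quasi_polish X).

Local Notation OGOX := (vaught_unions alpha open open).
Local Notation good := (good_points alpha).

Let scG : @second_countable G := has_convergent_base_second_countable cbG.
Let baireG : baire_space G := has_convergent_base_baire_space cbG.
Let cbX : has_convergent_base X := ((quasi_polishP X).1 qpX).2.
Let scX : @second_countable X := has_convergent_base_second_countable cbX.

Hypothesis openV : OGOX `<=` open.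
Variable topO : is_topology OGOX.

Definition good_action (p : G * set_type good) : topologized topO :=
  alpha (p.1, set_val p.2).

Lemma continuous_good_action : continuous good_action.
Proof.
apply: (vaught_action_continuous (i := set_val)
  (j := id : X -> topologized topO) alphaA scG scX) => // B OB.
by exists B => //; exact: openV.
Qed.

Lemma open_map_good_action : open_map good_action.
Proof.
have closure_open : union_closure (vaught_opens alpha) `<=` OGOX.
  by rewrite vaught_unionsE.
move=> N oN; apply: closure_open => _ [[g x] Ngx <-].
have [U [_ [oU [A oA <-] Ug Ax UAN]]] := open_prod_box oN Ngx.
exists (vaught alpha U A); split; first by exists U, A.
  by apply: good_points_vaught => //; exact: set_valP.
move=> y /(vaught_hit_good_points alphaA scG scX)[h [Uh Ah gh]].
pose z : set_type good := exist _ (alpha (h^-1%g, y)) (mem_set gh).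
by exists (h, z); [apply: UAN; split|exact: actVK].
Qed.

Lemma range_good_action : range good_action = setT.
Proof.
apply/seteqP; split=> // y _.
have [|g [_ _ gg]] := @vaught_hit_good_points _ _ _ alphaA scG scX setT setT y.
  by apply: (open_return_vaught alphaA baireG openT) => //; exists 1%g.
pose z : set_type good := exist _ (alpha (g^-1%g, y)) (mem_set gg).
by exists (g, z) => //; exact: actVK.
Qed.

Lemma kolmogorov_topologized : kolmogorov_space (topologized topO).
Proof.
have [T0X _] := (quasi_polishP X).1 qpX.
apply/kolmogorov_spaceP => x y xy; apply: (vaught_separates alphaA scX) => //.
move=> U A oU oA; apply: xy; rewrite open_topologizedE.
exact: vaught_in_unions.
Qed.

Lemma vaught_unions_quasi_polish : quasi_polish (topologized topO).
Proof.
apply/quasi_polishP; split; first exact: kolmogorov_topologized.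
apply: has_convergent_base_image continuous_good_action open_map_good_action
  range_good_action _.
by apply: has_convergent_base_prod => //;
  apply: has_convergent_base_Pi02 => //; exact: Pi02_good_points.
Qed.

End vaught_quasi_polish.

Theorem theorem3p3p1 (R : realType) (G : topologicalGroupType)
    (X : topologicalType) (alpha : G * X -> X) :
  polish R G -> quasi_polish X -> left_action alpha -> borel_map alpha ->
  let OGOX : set (set X) := vaught_unions alpha open open in
  let UA : set (set X) :=
    [set B | exists U A, [/\ open U, open A & B = vaught alpha U A]] in
  ([/\ continuous alpha <-> OGOX = open,
       OGOX = open <-> basis UA
     & OGOX = open <-> subbasis UA])
  /\
  (OGOX `<=` open ->
   exists topO : is_topology OGOX,
     [/\ OGOX `<=` @open X,
         quasi_polish (topologized topO),
         OGOX `<=` @borel X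
       & continuous
           (alpha : G * topologized topO -> topologized topO)]).
Proof.
move=> /polish_has_convergent_base cbG qpX alphaA balpha OGOX UA.
have scG := has_convergent_base_second_countable cbG.
have baireG := has_convergent_base_baire_space cbG.
have scX := has_convergent_base_second_countable ((quasi_polishP X).1 qpX).2.
have OGOXE : OGOX = union_closure UA := vaught_unionsE alphaA scG scX.
have topOGOX := vaught_unions_topology alphaA scG scX baireG.
split=> [|openV]; first split.
- split; first exact: continuous_vaught_unions.
  exact: vaught_unions_open_continuous.
- by rewrite OGOXE; exact: union_closure_basisP.
- by rewrite OGOXE; apply: union_closure_subbasisP; rewrite -OGOXE.
exists (topOGOX openV); split=> //.
- exact: vaught_unions_quasi_polish.
- by move=> B /openV; exact: sub_sigma_algebra.
- exact: vaught_unions_continuous.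
Qed.
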